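(* There is a bijective correspondence between (isomorphism classes of) (1) ko-spaces, (2) distributive bi-dcpos, and (3) distributive embedded bi-dcpos.
   Context: Directed: nonempty and every two elements have an upper bound in the set; codirected is the order dual. Ko-space: a triple $(X,\mathcal K,\mathcal O)$ with $X$ a poset and $\mathcal K,\mathcal O$ sets of upsets of $X$ such that: $\mathcal K$ is closed under codirected intersections and $\mathcal O$ under directed unions; for every $K\in\mathcal K$ and directed $\mathcal I\subseteq\mathcal O$ with $K\subseteq\bigcup\mathcal I$ there is $U\in\mathcal I$ with $K\subseteq U$; for every $U\in\mathcal O$ and codirected $\mathcal F\subseteq\mathcal K$ with $\bigcap\mathcal F\subseteq U$ there is $K\in\mathcal F$ with $K\subseteq U$; and for all $x\in X$, ${\uparrow}x\in\mathcal K$ and $X\setminus{\downarrow}x\in\mathcal O$. Polarity: a triple $(\mathcal K,\mathcal O,\vartriangleleft)$ of two sets and a relation $\vartriangleleft$ from $\mathcal K$ to $\mathcal O$. Put ${\uparrow_{\mathcal O}}k=\{u\in\mathcal O\mid k\vartriangleleft u\}$ for $k\in\mathcal K$, and ${\downarrow_{\mathcal K}}u=\{k\in\mathcal K\mid k\vartriangleleft u\}$ for $u\in\mathcal O$. Specialization preorders: for $k,l\in\mathcal K$, $k\le l$ iff ${\uparrow_{\mathcal O}}k\supseteq{\uparrow_{\mathcal O}}l$; for $u,v\in\mathcal O$, $u\le v$ iff ${\downarrow_{\mathcal K}}u\subseteq{\downarrow_{\mathcal K}}v$. The polarity is purified if both are partial orders. Put ${\downarrow_{\mathcal K}}k=\{l\in\mathcal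 K\mid l\le k\}$, ${\uparrow_{\mathcal O}}u=\{v\in\mathcal O\mid u\le v\}$. Bi-dcpo: a purified polarity such that, in the specialization orders, $\mathcal K$ has all codirected meets and $\mathcal O$ all directed joins; if $k\vartriangleleft\bigvee I$ with $k\in\mathcal K$ and $I\subseteq\mathcal O$ directed, then $k\vartriangleleft u$ for some $u\in I$; and if $\bigwedge F\vartriangleleft u$ with $u\in\mathcal O$ and $F\subseteq\mathcal K$ codirected, then $k\vartriangleleft u$ for some $k\in F$. A bi-dcpo is distributive if for all $k,l\in\mathcal K$, $u,v\in\mathcal O$: whenever (i) $k\vartriangleleft w$ for all $w\in{\uparrow_{\mathcal O}}u\cap{\uparrow_{\mathcal O}}l$, (ii) $l\vartriangleleft v$, and (iii) $m\vartriangleleft u$ for all $m\in{\downarrow_{\mathcal K}}v\cap{\downarrow_{\mathcal K}}k$, then $k\vartriangleleft u$. Embedded bi-dcpo: a triple $(L,\mathcal K,\mathcal O)$ with $L$ a complete lattice and $\mathcal K,\mathcal O\subseteq L$ such that every element of $L$ is a join of elements of $\mathcal K$ and a meet of elements of $\mathcal O$; $\mathcal K$ is closed in $L$ under codirected meets and $\mathcal O$ under directed joins; $k\le\bigvee I$ with $k\in\mathcal K$, $I\subseteq\mathcal O$ directed implies $k\le u$ for some $u\in I$; and $\bigwedge F\le u$ with $u\in\mathcal O$, $F\subseteq\mathcal K$ codirected implies $k\le u$ for some $k\in F$. It is distributive if the lattice $L$ is distributive. Isomorphisms are bijections (for polarities, pairs of bijections) preserving and reflecting all the structure. *)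

(* Defs.v *)
From HB Require Import structures.
From mathcomp Require Import all_boot all_order.
From mathcomp Require Import boolp classical_sets functions.

Set Implicit Arguments.
Unset Strict Implicit.
Unset Printing Implicit Defensive.

Import Order.TTheory.

Local Open Scope classical_set_scope.
Local Open Scope order_scope.

Section RelationOrder.
Variables (T : Type) (R : T -> T -> Prop).

Definition directed (S : set T) : Prop :=
  S !=set0 /\
  forall x y, S x -> S y -> exists z, [/\ S z, R x z & R y z].

Definition codirected (S : set T) : Prop :=
  S !=set0 /\
  forall x y, S x -> S y -> exists z, [/\ S z, R z x & R z y].

(* [supremums] and [infimums] of classical_sets need a [porderType]; these are
   their counterparts for an arbitrary relation. *)
Definition is_join (S : set T) (x : T) : Prop :=
  (forall y, S y -> R y x) /\ forall z, (forall y, S y -> R y z) -> R x z.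

Definition is_meet (S : set T) (x : T) : Prop :=
  (forall y, S y -> R x y) /\ forall z, (forall y, S y -> R z y) -> R z x.

End RelationOrder.

Definition upset d (X : porderType d) (A : set X) : Prop :=
  forall x y, x <= y -> A x -> A y.

(* Each kind of structure comes as a record of raw data together with
   predicates stating its axioms. *)

Record ko_data := KoData {
  ko_disp : Order.disp_t;
  ko_pt :> porderType ko_disp;
  ko_K : set (set ko_pt);
  ko_O : set (set ko_pt) }.

Record is_ko_space (X : ko_data) : Prop := {
  ko_K_upset : forall A, ko_K (k := X) A -> upset A;
  ko_O_upset : forall A, ko_O (k := X) A -> upset A;
  ko_K_bigcap : forall F : set (set X),
    F `<=` ko_K (k := X) -> codirected subset F ->
    ko_K (\bigcap_(A in F) A);
  ko_O_bigcup : forall I : set (set X),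
    I `<=` ko_O (k := X) -> directed subset I ->
    ko_O (\bigcup_(A in I) A);
  ko_K_compact : forall (A : set X) (I : set (set X)),
    ko_K A -> I `<=` ko_O (k := X) -> directed subset I ->
    A `<=` \bigcup_(U in I) U -> exists2 U, I U & A `<=` U;
  ko_O_cocompact : forall (U : set X) (F : set (set X)),
    ko_O U -> F `<=` ko_K (k := X) -> codirected subset F ->
    \bigcap_(A in F) A `<=` U -> exists2 A, F A & A `<=` U;
  ko_up_K : forall x : X, ko_K [set y : X | x <= y];
  ko_down_O : forall x : X, ko_O (~` [set y : X | y <= x]) }.

Definition ko_iso (X Y : ko_data) : Prop :=
  exists f : X -> Y,
    [/\ bijective f,
        {mono f : x y / x <= y},
        forall A : set X, ko_K (f @` A) <-> ko_K A &
        forall A : set X, ko_O (f @` A) <-> ko_O A].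

Record polarity := Polarity {
  pol_K : Type;
  pol_O : Type;
  pol_rel : pol_K -> pol_O -> Prop }.

Notation "k ◁ u" := (pol_rel k u) (at level 70, no associativity).

Definition pol_leK (P : polarity) (k l : pol_K P) : Prop :=
  [set u | l ◁ u] `<=` [set u | k ◁ u].

Definition pol_leO (P : polarity) (u v : pol_O P) : Prop :=
  [set k | k ◁ u] `<=` [set k | k ◁ v].

Definition purified (P : polarity) : Prop :=
  Relation_Definitions.order (pol_K P) (@pol_leK P) /\
  Relation_Definitions.order (pol_O P) (@pol_leO P).

Record is_bidcpo (P : polarity) : Prop := {
  bidcpo_purified : purified P;
  bidcpo_meets : forall F : set (pol_K P), codirected (@pol_leK P) F ->
    exists k, is_meet (@pol_leK P) F k;
  bidcpo_joins : forall I : set (pol_O P), directed (@pol_leO P) I ->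
    exists u, is_join (@pol_leO P) I u;
  bidcpo_compact : forall (k : pol_K P) (I : set (pol_O P)) (v : pol_O P),
    directed (@pol_leO P) I -> is_join (@pol_leO P) I v -> k ◁ v ->
    exists2 u, I u & k ◁ u;
  bidcpo_cocompact : forall (u : pol_O P) (F : set (pol_K P)) (l : pol_K P),
    codirected (@pol_leK P) F -> is_meet (@pol_leK P) F l -> l ◁ u ->
    exists2 k, F k & k ◁ u }.

Definition pol_distributive (P : polarity) : Prop :=
  forall (k l : pol_K P) (u v : pol_O P),
    (forall w, pol_leO u w -> l ◁ w -> k ◁ w) ->
    l ◁ v ->
    (forall m, m ◁ v -> pol_leK m k -> m ◁ u) ->
    k ◁ u.

Definition is_distr_bidcpo (P : polarity) : Prop :=
  is_bidcpo P /\ pol_distributive P.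

Definition pol_iso (P Q : polarity) : Prop :=
  exists (f : pol_K P -> pol_K Q) (g : pol_O P -> pol_O Q),
    [/\ bijective f, bijective g & forall k u, f k ◁ g u <-> k ◁ u].

Record emb_data := EmbData {
  emb_disp : Order.disp_t;
  emb_lat :> latticeType emb_disp;
  emb_K : set emb_lat;
  emb_O : set emb_lat }.

Definition complete_lattice d (L : latticeType d) : Prop :=
  forall S : set L, supremums S !=set0 /\ infimums S !=set0.

Record is_embedded_bidcpo (E : emb_data) : Prop := {
  emb_complete : complete_lattice E;
  emb_K_dense : forall a : E,
    exists2 S, S `<=` emb_K (e := E) & supremums S a;
  emb_O_dense : forall a : E,
    exists2 S, S `<=` emb_O (e := E) & infimums S a;
  emb_K_meets : forall (F : set E) (a : E),
    F `<=` emb_K (e := E) -> codirected (fun x y : E => x <= y) F ->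
    infimums F a -> emb_K a;
  emb_O_joins : forall (I : set E) (a : E),
    I `<=` emb_O (e := E) -> directed (fun x y : E => x <= y) I ->
    supremums I a -> emb_O a;
  emb_compact : forall (k : E) (I : set E) (a : E),
    emb_K k -> I `<=` emb_O (e := E) -> directed (fun x y : E => x <= y) I ->
    supremums I a -> k <= a -> exists2 u, I u & k <= u;
  emb_cocompact : forall (u : E) (F : set E) (a : E),
    emb_O u -> F `<=` emb_K (e := E) ->
    codirected (fun x y : E => x <= y) F ->
    infimums F a -> a <= u -> exists2 k, F k & k <= u }.

Definition is_distr_embedded_bidcpo (E : emb_data) : Prop :=
  is_embedded_bidcpo E /\
  left_distributive (@Order.meet _ E) (@Order.join _ E).

Definition emb_iso (E E' : emb_data) : Prop :=
  exists f : E -> E',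
    [/\ bijective f,
        {mono f : a b / a <= b},
        forall a, emb_K (f a) <-> emb_K a &
        forall a, emb_O (f a) <-> emb_O a].

Section UpsetLattice.
Variables (d : Order.disp_t) (X : porderType d).

Definition upsets : set (set X) := [set A | upset A].

Definition upset_lattice : Type := set_type upsets.

HB.instance Definition _ := SubChoice.on upset_lattice.

Fact upsets_meet_closed : meet_closed (mem upsets).
Proof.
move=> A B /set_mem uA /set_mem uB; apply/mem_set => x y xy [Ax Bx].
by split; [exact: uA xy Ax | exact: uB xy Bx].
Qed.

Fact upsets_join_closed : join_closed (mem upsets).
Proof.
move=> A B /set_mem uA /set_mem uB; apply/mem_set => x y xy.
by case=> [Ax | Bx]; [left; exact: uA xy Ax | right; exact: uB xy Bx].
Qed.

HB.instance Definition _ := Order.SubChoice_isSubLattice.Build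
  set_display (set X) (mem upsets) set_display upset_lattice
  upsets_meet_closed upsets_join_closed.

End UpsetLattice.

Definition ko_polarity (X : ko_data) : polarity :=
  Polarity (fun (A : {A : set X | ko_K A}) (U : {U : set X | ko_O U}) =>
    sval A `<=` sval U).

Definition emb_polarity (E : emb_data) : polarity :=
  Polarity (fun (k : {k : E | emb_K k}) (u : {u : E | emb_O u}) =>
    sval k <= sval u).

Definition ko_embedded (X : ko_data) : emb_data :=
  @EmbData set_display (upset_lattice X)
    [set A | ko_K (k := X) (val A)] [set A | ko_O (k := X) (val A)].

(* Classes are written as [T -> Prop] because [set] is universe monomorphic and
   cannot be applied to [ko_data], [polarity] or [emb_data]. *)
Record iso_classes T (P : T -> Prop) (iso : T -> T -> Prop) := IsoClass {
  iso_class_mem :> T -> Prop;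
  iso_classP :
    exists2 x, P x & iso_class_mem = (fun y => P y /\ iso x y) }.

(* As the members of [phi C] satisfy [P'] and are pairwise isomorphic, the second
   clause says that [f] sends structures satisfying [P] to structures satisfying
   [P'], respects isomorphism, and has [phi] as its action on classes. *)
Definition iso_class_bijection T T'
    (P : T -> Prop) (iso : T -> T -> Prop)
    (P' : T' -> Prop) (iso' : T' -> T' -> Prop) (f : T -> T') : Prop :=
  exists2 phi : iso_classes P iso -> iso_classes P' iso',
    bijective phi & forall (C : iso_classes P iso) x, C x -> phi C (f x).

(* Main.v *)
(* A point x of a ko-space is recovered from its polarity as the pair
   (up x, complement of down x): these are exactly the pairs (p, q) with p not
   related to q, p minimal and q maximal. In an arbitrary bi-dcpo P, Zorn's
   lemma and the two compactness axioms put such a pair below k and above u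
   whenever k is not related to u, and distributivity says that p <= k iff k is
   not related to q, for every k. Ordering these pairs by the reverse order of
   their first components yields a ko-space with polarity P. An embedded bi-dcpo
   is the Dedekind-MacNeille completion of its polarity, hence determined by it,
   and the upset lattice of a ko-space has the polarity of the space. *)
From HB Require Import structures.
Require Import Defs.
From mathcomp Require Import all_boot all_order.
From mathcomp Require Import boolp classical_sets functions.

Set Implicit Arguments.
Unset Strict Implicit.
Unset Printing Implicit Defensive.

Import Order.TTheory.

Local Open Scope order_scope.
Local Open Scope classical_set_scope.

(** * Isomorphism classes *)

(** The witness stored in a class is a proof, so proof irrelevance leaves only membership to
    compare. *)
Lemma iso_classes_ext T (P : T -> Prop) (iso : T -> T -> Prop)
    (C D : iso_classes P iso) : (forall x, C x <-> D x) -> C = D.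
Proof.
case: C D => [C HC] [D HD] /= CD.
have E : C = D by apply/funext => x; exact/propext.
by case: D / E HD {CD} => HD; congr IsoClass; exact: Prop_irrelevance.
Qed.

Lemma iso_class_memE T (P : T -> Prop) (iso : T -> T -> Prop)
    (C : iso_classes P iso) :
  exists2 x, P x & forall y, C y <-> P y /\ iso x y.
Proof. by case: C => C [x Px CE] /=; exists x => // y; rewrite CE. Qed.

Section IsoClassBijection.
Variables (T T' : Type) (P : T -> Prop) (iso : T -> T -> Prop).
Variables (P' : T' -> Prop) (iso' : T' -> T' -> Prop) (f : T -> T').
Hypothesis iso_refl : forall x, iso x x.
Hypothesis iso_trans : forall x y z, iso x y -> iso y z -> iso x z.
Hypothesis iso'_refl : forall x, iso' x x.
Hypothesis iso'_sym : forall x y, iso' x y -> iso' y x.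
Hypothesis iso'_trans : forall x y z, iso' x y -> iso' y z -> iso' x z.
Hypothesis fP : forall x, P x -> P' (f x).
Hypothesis f_iso : forall x y, P x -> P y -> (iso' (f x) (f y) <-> iso x y).
Hypothesis f_surj : forall y, P' y -> exists2 x, P x & iso' (f x) y.

(** The inverse on classes is preimage along [f]. Essential surjectivity [f_surj] gives the preimage
    of a class a member, and reflection of isomorphisms makes it a single class. *)
Lemma iso_class_bijectionP : iso_class_bijection P iso P' iso' f.
Proof.
have Pphi (C : iso_classes P iso) : exists2 y, P' y &
    (fun z => P' z /\ exists2 x, C x & iso' (f x) z) =
    (fun z => P' z /\ iso' y z).
  have [x Px CE] := iso_class_memE C; exists (f x); first exact: fP.
  apply/funext => z; apply/propext; split=> -[P'z].
    case=> y /CE[Py xy] yz; split=> //.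
    by apply: iso'_trans yz; apply/f_iso.
  by move=> xz; split=> //; exists x => //; apply/CE.
have Ppsi (D : iso_classes P' iso') : exists2 x, P x &
    (fun z => P z /\ D (f z)) = (fun z => P z /\ iso x z).
  have [y P'y DE] := iso_class_memE D; have [x Px xy] := f_surj P'y.
  exists x => //; apply/funext => z; apply/propext; split=> -[Pz].
    case/DE=> _ yz; split=> //; apply/f_iso => //.
    exact: iso'_trans xy yz.
  move=> xz; split=> //; apply/DE; split; first exact: fP.
  by apply: iso'_trans (iso'_sym xy) _; apply/f_iso.
exists (fun C => IsoClass (Pphi C)); last first.
  move=> C x Cx /=; split; last by exists x.
  by have [y _ CE] := iso_class_memE C; have /CE[Px _] := Cx; exact: fP.
exists (fun D => IsoClass (Ppsi D)) => [C | D]; apply: iso_classes_ext => z /=.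
  have [x Px CE] := iso_class_memE C; split.
    case=> Pz [_ [y /CE[Py xy] yz]]; apply/CE; split=> //.
    by apply: iso_trans xy _; apply/f_iso.
  by move=> /[dup] Cz /CE[Pz _]; split=> //; split; [exact: fP | exists z].
have [y P'y DE] := iso_class_memE D; split.
  case=> P'z [x [Px /DE[_ yx]] xz]; apply/DE; split=> //.
  exact: iso'_trans yx xz.
case/DE=> P'z yz; split=> //; have [x Px xz] := f_surj P'z; exists x => //.
split=> //; apply/DE; split; first exact: fP.
exact: iso'_trans yz (iso'_sym xz).
Qed.

End IsoClassBijection.

(** * Bijections, subtypes and images *)

Lemma inj_surj_bijective (T T' : Type) (h : T -> T') :
  injective h -> (forall y, exists x, h x = y) -> bijective h.
Proof.
move=> h_inj /choice[g hg]; exists g => // x.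
exact: h_inj.
Qed.

Lemma sval_inj T (P : T -> Prop) : injective (fun x : {x | P x} => sval x).
Proof. by move=> [x px] [y py] /= xy; exact: eq_exist. Qed.

(** Source of the two components of the polarity isomorphisms induced by a map of ambient types. *)
Lemma sig_bijection (T T' : Type) (P : T -> Prop) (P' : T' -> Prop)
    (h : T -> T') :
  (forall x y, P x -> P y -> h x = h y -> x = y) ->
  (forall x, P x -> P' (h x)) ->
  (forall y, P' y -> exists2 x, P x & h x = y) ->
  exists2 f : {x | P x} -> {y | P' y},
    bijective f & forall x, sval (f x) = h (sval x).
Proof.
move=> h_inj hP h_surj.
exists (fun x => exist _ (h (sval x)) (hP _ (svalP x))) => //.
apply: inj_surj_bijective => [x y [/h_inj xy] | [y P'y]].
  by apply: sval_inj; apply: xy; exact: svalP.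
by have [x Px hxy] := h_surj y P'y; exists (exist _ x Px); exact: eq_exist.
Qed.

Lemma image_bijective (T T' : Type) (h : T -> T') :
  bijective h -> bijective (fun A : set T => h @` A).
Proof.
case=> g hK gK; exists (fun B => g @` B) => A; rewrite image_comp.
  by rewrite (eq_imagel (f' := id)) ?image_id // => x _; exact: hK.
by rewrite (eq_imagel (f' := id)) ?image_id // => x _; exact: gK.
Qed.

Lemma directed_image T T' (R : T -> T -> Prop) (R' : T' -> T' -> Prop)
    (h : T -> T') (S : set T) :
  (forall x y, R x y -> R' (h x) (h y)) ->
  directed R S -> directed R' (h @` S).
Proof.
move=> hR [[x Sx] RS]; split; first by exists (h x), x.
move=> _ _ [y Sy <-] [z Sz <-]; have [t [St yt zt]] := RS y z Sy Sz.
by exists (h t); split; [exists t | exact: hR | exact: hR].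
Qed.

Lemma codirected_image T T' (R : T -> T -> Prop) (R' : T' -> T' -> Prop)
    (h : T -> T') (S : set T) :
  (forall x y, R x y -> R' (h x) (h y)) ->
  codirected R S -> codirected R' (h @` S).
Proof.
by move=> hR; apply: (@directed_image _ _ (fun x y => R y x)) => x y; exact: hR.
Qed.

(** * Isomorphism relations of the three kinds of structure *)

Lemma ko_iso_refl X : ko_iso X X.
Proof.
exists id; split=> //; first by exists id.
all: by move=> A; rewrite image_id.
Qed.

Lemma ko_iso_trans X Y Z : ko_iso X Y -> ko_iso Y Z -> ko_iso X Z.
Proof.
case=> h [hbij h_le hK hO] [g [gbij g_le gK gO]].
exists (g \o h); split.
- exact: bij_comp.
- by move=> x y /=; rewrite g_le h_le.
- by move=> A; rewrite -image_comp gK hK.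
- by move=> A; rewrite -image_comp gO hO.
Qed.

Lemma pol_iso_refl P : pol_iso P P.
Proof. by exists id, id; split=> //; exists id. Qed.

Lemma pol_iso_sym P Q : pol_iso P Q -> pol_iso Q P.
Proof.
case=> f [g [[f' fK f'K] [g' gK g'K] fg]].
exists f', g'; split; [by exists f | by exists g |].
by move=> k u; rewrite -fg f'K g'K.
Qed.

Lemma pol_iso_trans P Q R : pol_iso P Q -> pol_iso Q R -> pol_iso P R.
Proof.
case=> f [g [fbij gbij fg]] [f' [g' [f'bij g'bij fg']]].
exists (f' \o f), (g' \o g); split; try exact: bij_comp.
by move=> k u /=; rewrite fg' fg.
Qed.

Lemma emb_iso_refl E : emb_iso E E.
Proof. by exists id; split=> //; exists id. Qed.

Lemma emb_iso_sym E F : emb_iso E F -> emb_iso F E.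
Proof.
case=> h [[g hK gK] h_le hK' hO]; exists g; split.
- by exists h.
- by move=> x y; rewrite -h_le !gK.
- by move=> a; rewrite -hK' gK.
- by move=> a; rewrite -hO gK.
Qed.

Lemma emb_iso_trans E F G : emb_iso E F -> emb_iso F G -> emb_iso E G.
Proof.
case=> h [hbij h_le hK hO] [g [gbij g_le gK gO]].
exists (g \o h); split.
- exact: bij_comp.
- by move=> x y /=; rewrite g_le h_le.
- by move=> a /=; rewrite gK hK.
- by move=> a /=; rewrite gO hO.
Qed.

(** * The polarity of a ko-space *)

Lemma pol_leK_refl P (k : pol_K P) : pol_leK k k.
Proof. by []. Qed.

Lemma pol_leK_trans P (k l m : pol_K P) :
  pol_leK k l -> pol_leK l m -> pol_leK k m.
Proof. by move=> kl lm u /lm /kl. Qed.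

Lemma pol_leO_refl P (u : pol_O P) : pol_leO u u.
Proof. by []. Qed.

Lemma pol_leO_trans P (u v w : pol_O P) :
  pol_leO u v -> pol_leO v w -> pol_leO u w.
Proof. by move=> uv vw k /uv /vw. Qed.

Lemma pol_purifiedP P :
  purified P <-> (forall k l : pol_K P, pol_leK k l -> pol_leK l k -> k = l) /\
                 (forall u v : pol_O P, pol_leO u v -> pol_leO v u -> u = v).
Proof.
split=> [[[_ _ aK] [_ _ aO]] | [aK aO]].
  by split=> x y; [exact: aK | exact: aO].
split; split=> // [x | x y z].
- exact: pol_leK_refl.
- exact: pol_leK_trans.
- exact: pol_leO_refl.
- exact: pol_leO_trans.
Qed.

Section KoPolarity.
Variables (X : ko_data) (HX : is_ko_space X).

Definition ko_up (x : X) : pol_K (ko_polarity X) :=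
  exist _ [set y | x <= y] (ko_up_K HX x).

Definition ko_codown (x : X) : pol_O (ko_polarity X) :=
  exist _ (~` [set y | y <= x]) (ko_down_O HX x).

Lemma ko_up_sub (A : set X) x : upset A -> (sval (ko_up x) `<=` A) <-> A x.
Proof.
move=> uA; split=> [|Ax y /= xy]; last exact: uA xy Ax.
by apply; exact: lexx.
Qed.

Lemma sub_ko_codown (A : set X) x :
  upset A -> (A `<=` sval (ko_codown x)) <-> ~ A x.
Proof.
move=> uA; split=> [Ax /Ax /=|nAx y Ay /= yx]; first by apply; exact: lexx.
by apply: nAx; exact: uA yx Ay.
Qed.

Lemma ko_polK_upset (A : pol_K (ko_polarity X)) : upset (sval A).
Proof. exact: (ko_K_upset HX (svalP A)). Qed.

Lemma ko_polO_upset (U : pol_O (ko_polarity X)) : upset (sval U).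
Proof. exact: (ko_O_upset HX (svalP U)). Qed.

(** A point [x] of [A] outside [B] is detected by the complement of its principal downset, which
    contains [B] but not [A]. Dually, [ko_leO] tests with principal upsets. *)
Lemma ko_leK (A B : pol_K (ko_polarity X)) :
  pol_leK A B <-> sval A `<=` sval B.
Proof.
split=> [AB x Ax|AB U /=]; last exact: subset_trans.
apply: contrapT => nBx.
have /AB /sub_ko_codown : sval B `<=` sval (ko_codown x).
  exact/sub_ko_codown/nBx/ko_polK_upset.
by apply=> //; exact: ko_polK_upset.
Qed.

Lemma ko_leO (U V : pol_O (ko_polarity X)) :
  pol_leO U V <-> sval U `<=` sval V.
Proof.
split=> [UV x Ux|UV A /= AU]; last exact: subset_trans AU UV.
have /UV /ko_up_sub : sval (ko_up x) `<=` sval U.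
  exact/ko_up_sub/Ux/ko_polO_upset.
by apply=> //; exact: ko_polO_upset.
Qed.

Lemma ko_leK_up (A : pol_K (ko_polarity X)) x :
  pol_leK (ko_up x) A <-> sval A x.
Proof. by rewrite ko_leK ko_up_sub //; exact: ko_polK_upset. Qed.

Lemma ko_leK_anti (A B : pol_K (ko_polarity X)) :
  pol_leK A B -> pol_leK B A -> A = B.
Proof. by move=> /ko_leK AB /ko_leK BA; apply/sval_inj/seteqP. Qed.

Lemma ko_leO_anti (U V : pol_O (ko_polarity X)) :
  pol_leO U V -> pol_leO V U -> U = V.
Proof. by move=> /ko_leO UV /ko_leO VU; apply/sval_inj/seteqP. Qed.

(** Each point [x] of the intersection yields the lower bound [ko_up x], which must then lie below
    the meet. *)
Lemma ko_meetE (F : set (pol_K (ko_polarity X))) A :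
  is_meet (@pol_leK _) F A ->
  sval A = \bigcap_(B in [set sval B | B in F]) B.
Proof.
case=> lb glb; apply/seteqP; split=> [x Ax _ [B FB <-] | x Fx].
  by have /ko_leK := lb B FB; apply.
apply/ko_leK_up/glb => B FB; apply/ko_leK_up.
by apply: Fx; exists B.
Qed.

(** Each point [x] outside the union yields the upper bound [ko_codown x], so the join misses [x]
    too. *)
Lemma ko_joinE (I : set (pol_O (ko_polarity X))) U :
  is_join (@pol_leO _) I U ->
  sval U = \bigcup_(V in [set sval V | V in I]) V.
Proof.
case=> ub lub; apply/seteqP; split=> [x Ux | x [_ [V IV <-] Vx]]; last first.
  by have /ko_leO := ub V IV; apply.
apply: contrapT => nIx.
have /ko_leO/sub_ko_codown : pol_leO U (ko_codown x).
  apply: lub => V IV; apply/ko_leO/sub_ko_codown; first exact: ko_polO_upset.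
  by move=> Vx; apply: nIx; exists (sval V) => //; exists V.
by apply=> //; exact: ko_polO_upset.
Qed.

Lemma codirected_sval_ko (F : set (pol_K (ko_polarity X))) :
  codirected (@pol_leK _) F -> codirected subset [set sval B | B in F].
Proof. by apply: codirected_image => A B /ko_leK. Qed.

Lemma directed_sval_ko (I : set (pol_O (ko_polarity X))) :
  directed (@pol_leO _) I -> directed subset [set sval B | B in I].
Proof. by apply: directed_image => A B /ko_leO. Qed.

Lemma ko_polarity_bidcpo : is_bidcpo (ko_polarity X).
Proof.
have subK (F : set (pol_K (ko_polarity X))) :
    [set sval B | B in F] `<=` ko_K (k := X).
  by move=> _ [B _ <-]; exact: svalP.
have subO (I : set (pol_O (ko_polarity X))) :
    [set sval B | B in I] `<=` ko_O (k := X).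
  by move=> _ [B _ <-]; exact: svalP.
split.
- by apply/pol_purifiedP; split=> x y; [exact: ko_leK_anti|exact: ko_leO_anti].
- move=> F Fdir.
  exists (exist _ _ (ko_K_bigcap HX (subK F) (codirected_sval_ko Fdir))).
  split=> [A FA | A FA]; apply/ko_leK => x /= Ax.
    by apply: Ax; exists A.
  by move=> _ [B FB <-]; have /ko_leK := FA B FB; apply.
- move=> I Idir.
  exists (exist _ _ (ko_O_bigcup HX (subO I) (directed_sval_ko Idir))).
  split=> [U IU | U IU]; apply/ko_leO => x /=.
    by exists (sval U) => //; exists U.
  by case=> _ [V IV <-]; have /ko_leO := IU V IV; apply.
- move=> A I U Idir /ko_joinE /= ->.
  move/(ko_K_compact HX (svalP A) (subO I) (directed_sval_ko Idir)).
  by case=> _ [V IV <-]; exists V.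
- move=> U F A Fdir /ko_meetE /= ->.
  move/(ko_O_cocompact HX (svalP U) (subK F) (codirected_sval_ko Fdir)).
  by case=> _ [B FB <-]; exists B.
Qed.

(** Argue at a point [x] of [k] outside [u]. Hypothesis (i) for the complement of the downset of [x]
    forces [x] into [l], hence into [v] by (ii); then (iii) for the upset of [x] puts [x] in [u]. *)
Lemma ko_polarity_distributive : pol_distributive (ko_polarity X).
Proof.
move=> k l u v klu lv kvu x kx; apply: contrapT => nux.
have lx : sval l x.
  apply: contrapT => nlx.
  have /sub_ko_codown : k ◁ ko_codown x.
    apply: klu.
      by apply/ko_leO/sub_ko_codown => //; exact: ko_polO_upset.
    by apply/sub_ko_codown => //; exact: ko_polK_upset.
  by apply=> //; exact: ko_polK_upset.
apply: nux; have /ko_up_sub : ko_up x ◁ u.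
  apply: kvu; last exact/ko_leK_up.
  by apply/ko_up_sub; [exact: ko_polO_upset | exact: lv].
by apply; exact: ko_polO_upset.
Qed.

End KoPolarity.

Lemma ko_polarity_distr_bidcpo X :
  is_ko_space X -> is_distr_bidcpo (ko_polarity X).
Proof.
by split; [exact: ko_polarity_bidcpo | exact: ko_polarity_distributive].
Qed.

(** * Isomorphisms of ko-spaces and of their polarities *)

Lemma ko_polarity_iso X Y :
  ko_iso X Y -> pol_iso (ko_polarity X) (ko_polarity Y).
Proof.
case=> h [hbij _ hK hO].
have hinj := bij_inj (image_bijective hbij).
have [h' _ h'K] := image_bijective hbij.
have [f fbij fE] : exists2 f : pol_K (ko_polarity X) -> pol_K (ko_polarity Y),
    bijective f & forall A, sval (f A) = h @` sval A.
  apply: (@sig_bijection _ _ (ko_K (k := X)) (ko_K (k := Y))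
    (fun A => h @` A)) => [A B _ _ /hinj // | A /hK // | B KB].
  by exists (h' B); [apply/hK; rewrite h'K | rewrite h'K].
have [g gbij gE] : exists2 g : pol_O (ko_polarity X) -> pol_O (ko_polarity Y),
    bijective g & forall A, sval (g A) = h @` sval A.
  apply: (@sig_bijection _ _ (ko_O (k := X)) (ko_O (k := Y))
    (fun A => h @` A)) => [A B _ _ /hinj // | A /hO // | B OB].
  by exists (h' B); [apply/hO; rewrite h'K | rewrite h'K].
exists f, g; split=> // A U; rewrite /= fE gE; split=> [AU x Ax|]; last first.
  exact: image_subset.
have : (h @` sval U) (h x) by apply: AU; exists x.
by rewrite image_inj //; exact: bij_inj.
Qed.

Lemma pol_iso_leK P Q (f : pol_K P -> pol_K Q) (g : pol_O P -> pol_O Q) k l :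
  bijective g -> (forall k u, f k ◁ g u <-> k ◁ u) ->
  pol_leK (f k) (f l) <-> pol_leK k l.
Proof.
move=> [g' gK g'K] fg; split=> kl u /=.
  by move=> /fg /kl /fg.
by rewrite -[u]g'K !fg; exact: kl.
Qed.

Section KoPolarityReflectsIso.
Variables (X Y : ko_data) (HX : is_ko_space X) (HY : is_ko_space Y).
Variables (f : pol_K (ko_polarity X) -> pol_K (ko_polarity Y)).
Variables (g : pol_O (ko_polarity X) -> pol_O (ko_polarity Y)).
Hypotheses (fbij : bijective f) (gbij : bijective g).
Hypothesis fg : forall k u, f k ◁ g u <-> k ◁ u.

(* Any y in f (up x) but not in g (complement of down x) works: up y is below
   f (up x) and unrelated to g (complement of down x), so by minimality of up x
   the two agree. *)
Lemma pol_iso_ko_up x : exists y, f (ko_up HX x) = ko_up HY y.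
Proof.
have [f' fK f'K] := fbij.
have [y [fy ngy]] : exists y, sval (f (ko_up HX x)) y /\
                              ~ sval (g (ko_codown HX x)) y.
  apply: contrapT => nex.
  have /fg/(_ x) : f (ko_up HX x) ◁ g (ko_codown HX x).
    by move=> y fy; apply: contrapT => ngy; apply: nex; exists y.
  by apply; exact: lexx.
exists y; apply: (ko_leK_anti HY); last by apply/ko_leK_up.
rewrite -(f'K (ko_up HY y)) (pol_iso_leK _ _ gbij fg).
apply/(ko_leK_up HX); apply: contrapT => nx; apply: ngy.
have /fg : f' (ko_up HY y) ◁ ko_codown HX x.
  by apply/sub_ko_codown => //; exact: (ko_polK_upset HX).
by rewrite f'K => /(_ y); apply; exact: lexx.
Qed.

End KoPolarityReflectsIso.

(** Since [f] sends principal upsets to principal upsets, it induces a map [h] of points. Membership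
    of [x] in a set of either family is a statement about [ko_up x] in the polarity, so taking
    images under [h] agrees with [f] and [g]. *)
Lemma ko_polarity_reflects_iso X Y : is_ko_space X -> is_ko_space Y ->
  pol_iso (ko_polarity X) (ko_polarity Y) -> ko_iso X Y.
Proof.
move=> HX HY [f [g [fbij gbij fg]]].
have [f' fK f'K] := fbij; have [g' gK g'K] := gbij.
have [h hE] := choice (pol_iso_ko_up HX HY fbij gbij fg).
have fleK k l := pol_iso_leK k l gbij fg.
have h_le : {mono h : x y / x <= y}.
  move=> x y; apply/idP/idP.
    move=> hxy; apply/(ko_leK_up HX (ko_up HX x))/fleK.
    by rewrite !hE; apply/(ko_leK_up HY).
  move=> xy; apply/(ko_leK_up HY (ko_up HY (h x))).
  by rewrite -!hE; apply/fleK/(ko_leK_up HX).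
(* The inverse pair also sends principal upsets to principal upsets. *)
have h_surj y : exists x, h x = y.
  have fg' k u : f' k ◁ g' u <-> k ◁ u by rewrite -fg f'K g'K.
  have [||x xE] := pol_iso_ko_up HY HX _ _ fg' y; [by exists f|by exists g|].
  exists x; have : ko_up HY (h x) = ko_up HY y by rewrite -hE -xE f'K.
  move=> /(congr1 sval) /= /seteqP[xy yx].
  by apply/eqP; rewrite eq_le yx ?xy //=.
have h_inj : injective h by exact: inc_inj.
have hK A : h @` sval A = sval (f A).
  apply/seteqP; split=> [_ [x Ax <-] | y].
    by apply/(ko_leK_up HY); rewrite -hE; apply/fleK/(ko_leK_up HX).
  have [x <-] := h_surj y => /(ko_leK_up HY).
  rewrite -hE => /fleK/(ko_leK_up HX).
  by exists x.
have hO U : h @` sval U = sval (g U).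
  apply/seteqP; split=> [_ [x Ux <-] | y].
    apply/(ko_up_sub HY); first exact: (ko_polO_upset HY).
    by rewrite -hE; apply/fg/(ko_up_sub HX) => //; exact: (ko_polO_upset HX).
  have [x <-] := h_surj y.
  move=> /(ko_up_sub HY)-/(_ (@ko_polO_upset _ HY _)); rewrite -hE.
  move=> /fg/(ko_up_sub HX)-/(_ (@ko_polO_upset _ HX _)).
  by exists x.
(* If the image of [A] is in the family of [Y], the inverse of [f] or [g] gives a member of the
   family of [X] with the same image; injectivity on sets identifies it with [A]. *)
have im_inj := bij_inj (image_bijective (inj_surj_bijective h_inj h_surj)).
exists h; split=> //; first exact: inj_surj_bijective.
- move=> A; split=> KA.
    have := hK (f' (exist _ _ KA)); rewrite f'K /= => /im_inj <-.
    exact: svalP.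
  by rewrite (hK (exist _ _ KA)); exact: svalP.
- move=> A; split=> OA.
    have := hO (g' (exist _ _ OA)); rewrite g'K /= => /im_inj <-.
    exact: svalP.
  by rewrite (hO (exist _ _ OA)); exact: svalP.
Qed.

(** * The polarity of an embedded bi-dcpo *)

Lemma supremums_le d (T : porderType d) (S : set T) a b :
  supremums S a -> ((a <= b)%O <-> forall x, S x -> (x <= b)%O).
Proof.
case=> ub lub; split=> [ab x /ub xa|]; last exact: lub.
exact: le_trans xa ab.
Qed.

Lemma infimums_ge d (T : porderType d) (S : set T) a b :
  infimums S a -> ((b <= a)%O <-> forall x, S x -> (b <= x)%O).
Proof.
case=> lb glb; split=> [ba x /lb ax|]; last exact: glb.
exact: le_trans ba ax.
Qed.

Section EmbPolarity.
Variables (E : emb_data) (HE : is_embedded_bidcpo E).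

(** Join-density recast as an order test. With its dual [emb_leO_dense], it identifies the
    specialization orders with the order of the lattice. *)
Lemma emb_leK_dense (a b : E) :
  (forall k : pol_K (emb_polarity E), sval k <= a -> sval k <= b) -> a <= b.
Proof.
have [S SK Sa] := emb_K_dense HE a => ab; apply/(supremums_le _ Sa) => k Sk.
apply: (ab (exist _ k (SK _ Sk))); exact: (Sa.1 _ Sk).
Qed.

Lemma emb_leO_dense (a b : E) :
  (forall u : pol_O (emb_polarity E), b <= sval u -> a <= sval u) -> a <= b.
Proof.
have [S SO Sb] := emb_O_dense HE b => ab; apply/(infimums_ge _ Sb) => u Su.
apply: (ab (exist _ u (SO _ Su))); exact: (Sb.1 _ Su).
Qed.

Lemma emb_leK (k l : pol_K (emb_polarity E)) :
  pol_leK k l <-> sval k <= sval l.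
Proof.
split=> [kl|kl u /= lu]; last exact: le_trans kl lu.
by apply: emb_leO_dense => u; exact: kl.
Qed.

Lemma emb_leO (u v : pol_O (emb_polarity E)) :
  pol_leO u v <-> sval u <= sval v.
Proof.
split=> [uv|uv k /= ku]; last exact: le_trans ku uv.
by apply: emb_leK_dense => k; exact: uv.
Qed.

Lemma codirected_sval_emb (F : set (pol_K (emb_polarity E))) :
  codirected (@pol_leK _) F ->
  codirected (fun x y : E => x <= y) [set sval k | k in F].
Proof. by apply: codirected_image => k l /emb_leK. Qed.

Lemma directed_sval_emb (I : set (pol_O (emb_polarity E))) :
  directed (@pol_leO _) I ->
  directed (fun x y : E => x <= y) [set sval u | u in I].
Proof. by apply: directed_image => u v /emb_leO. Qed.

(** A lower bound in the lattice is tested by the elements of [emb_K] below it; these are lower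
    bounds of [F] within [emb_K], hence below [k]. *)
Lemma emb_meet_infimums (F : set (pol_K (emb_polarity E))) k :
  is_meet (@pol_leK _) F k -> infimums [set sval l | l in F] (sval k).
Proof.
case=> lb glb; split=> [_ [l Fl <-] | a aF]; first by apply/emb_leK/lb.
apply: emb_leK_dense => m ma; apply/emb_leK/glb => l Fl; apply/emb_leK.
by apply: le_trans ma (aF _ _); exists l.
Qed.

Lemma emb_join_supremums (I : set (pol_O (emb_polarity E))) u :
  is_join (@pol_leO _) I u -> supremums [set sval v | v in I] (sval u).
Proof.
case=> ub lub; split=> [_ [v Iv <-] | a aI]; first by apply/emb_leO/ub.
apply: emb_leO_dense => w aw; apply/emb_leO/lub => v Iv; apply/emb_leO.
by apply: le_trans (aI _ _) aw; exists v.
Qed.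

Lemma emb_polarity_bidcpo : is_bidcpo (emb_polarity E).
Proof.
have subK (F : set (pol_K (emb_polarity E))) :
    [set sval k | k in F] `<=` emb_K (e := E).
  by move=> _ [k _ <-]; exact: svalP.
have subO (I : set (pol_O (emb_polarity E))) :
    [set sval u | u in I] `<=` emb_O (e := E).
  by move=> _ [u _ <-]; exact: svalP.
split.
- apply/pol_purifiedP; split=> x y.
    move=> /emb_leK xy /emb_leK yx.
    by apply: sval_inj; apply/eqP; rewrite eq_le xy yx.
  move=> /emb_leO xy /emb_leO yx.
  by apply: sval_inj; apply/eqP; rewrite eq_le xy yx.
- move=> F /codirected_sval_emb Fdir.
  have [_ [a aF]] := emb_complete HE [set sval k | k in F].
  exists (exist _ a (emb_K_meets HE (subK F) Fdir aF)).
  split=> [k Fk | k kF]; apply/emb_leK => /=; first by apply: aF.1; exists k.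
  by apply: aF.2 => _ [l Fl <-]; exact/emb_leK/kF.
- move=> I /directed_sval_emb Idir.
  have [[a aI] _] := emb_complete HE [set sval u | u in I].
  exists (exist _ a (emb_O_joins HE (subO I) Idir aI)).
  split=> [u Iu | u uI]; apply/emb_leO => /=; first by apply: aI.1; exists u.
  by apply: aI.2 => _ [l Il <-]; exact/emb_leO/uI.
- move=> k I u /directed_sval_emb Idir /emb_join_supremums supI.
  move/(emb_compact HE (svalP k) (subO I) Idir supI).
  by case=> _ [v Iv <-]; exists v.
- move=> u F k /codirected_sval_emb Fdir /emb_meet_infimums infF.
  move/(emb_cocompact HE (svalP u) (subK F) Fdir infF).
  by case=> _ [l Fl <-]; exists l.
Qed.

(** By density, (i) gives that [k] is below the join of [u] and [l], while (ii) and (iii) give that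
    the meet of [k] and [l] is below [u]. Distributing [k] over that join leaves two terms, both
    below [u]. *)
Lemma emb_polarity_distributive :
  left_distributive (@Order.meet _ E) (@Order.join _ E) ->
  pol_distributive (emb_polarity E).
Proof.
move=> distr k l u v klu lv kvu; rewrite /=.
have ku : sval k <= (sval u `|` sval l)%O.
  apply: emb_leO_dense => w; rewrite leUx => /andP[uw lw].
  by apply: klu => //; exact/emb_leO.
rewrite -(meet_l ku) meetC distr leUx leIl /=.
apply: emb_leK_dense => m; rewrite lexI => /andP[ml mk].
by apply: kvu; [exact: le_trans ml lv | exact/emb_leK].
Qed.

End EmbPolarity.

Lemma emb_polarity_distr_bidcpo E :
  is_distr_embedded_bidcpo E -> is_distr_bidcpo (emb_polarity E).
Proof.
case=> HE distr; split; first exact: emb_polarity_bidcpo.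
exact: emb_polarity_distributive.
Qed.

(** * Isomorphisms of embedded bi-dcpos and of their polarities *)

Lemma emb_polarity_iso E F :
  emb_iso E F -> pol_iso (emb_polarity E) (emb_polarity F).
Proof.
case=> h [[h' hK' h'K] h_le hK hO].
have [f fbij fE] : exists2 f : pol_K (emb_polarity E) -> pol_K (emb_polarity F),
    bijective f & forall k, sval (f k) = h (sval k).
  apply: (@sig_bijection _ _ (emb_K (e := E)) (emb_K (e := F)) h).
  - by move=> a b _ _ /(can_inj hK').
  - by move=> a /hK.
  - by move=> b Kb; exists (h' b) => //; apply/hK; rewrite h'K.
have [g gbij gE] : exists2 g : pol_O (emb_polarity E) -> pol_O (emb_polarity F),
    bijective g & forall k, sval (g k) = h (sval k).
  apply: (@sig_bijection _ _ (emb_O (e := E)) (emb_O (e := F)) h).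
  - by move=> a b _ _ /(can_inj hK').
  - by move=> a /hO.
  - by move=> b Ob; exists (h' b) => //; apply/hO; rewrite h'K.
by exists f, g; split=> // k u /=; rewrite fE gE h_le.
Qed.

(** The image of [a] is the join of the [f k] with [k] below [a]. It is pinned down by the elements
    [g u] above it, namely those with [u] above [a], and all other properties of [h] are read off
    from this. *)
Lemma emb_polarity_reflects_iso E F :
  is_embedded_bidcpo E -> is_embedded_bidcpo F ->
  pol_iso (emb_polarity E) (emb_polarity F) -> emb_iso E F.
Proof.
move=> HE HF [f [g [[f' fK f'K] [g' gK g'K] fg]]].
have eq_leO (b c : F) :
    (forall u, b <= sval (g u) <-> c <= sval (g u)) -> b = c.
  move=> bc; apply/eqP; rewrite eq_le; apply/andP.
  by split; apply: (emb_leO_dense HF) => u; rewrite -(g'K u) => /bc.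
have h_ex (a : E) : exists b : F, forall u, b <= sval (g u) <-> a <= sval u.
  have [[b bS] _] :=
    emb_complete HF [set sval (f k) | k in [set k | sval k <= a]].
  exists b => u; rewrite (supremums_le _ bS); split=> [ub | au _ [k ka <-]].
    by apply: (emb_leK_dense HE) => k ka; apply/fg/ub; exists k.
  by apply/fg; exact: le_trans ka au.
have [h hE] := choice h_ex.
have h_le : {mono h : a b / a <= b}.
  move=> a b; apply/idP/idP => ab.
    apply: (emb_leO_dense HE) => u bu; apply/hE.
    by apply: le_trans ab _; exact/hE.
  apply: (emb_leO_dense HF) => u; rewrite -(g'K u) => /hE bu.
  by apply/hE; exact: le_trans ab bu.
have h_inj : injective h by exact: inc_inj.
(* The preimage of [b] is the join of the [k] with [f k] below [b]. *)
have h_surj b : exists a, h a = b.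
  have [[a aS] _] :=
    emb_complete HE [set sval k | k in [set k | sval (f k) <= b]].
  exists a; apply: eq_leO => u; rewrite hE (supremums_le _ aS).
  split=> [ua | bu _ [k kb <-]]; last by apply/fg; exact: le_trans kb bu.
  apply: (emb_leK_dense HF) => k; rewrite -(f'K k) => kb.
  by apply/fg/ua; exists (f' k).
have hK k : h (sval k) = sval (f k).
  by apply: eq_leO => u; rewrite hE; exact: iff_sym (fg k u).
have hO u : h (sval u) = sval (g u).
  apply/eqP; rewrite eq_le; apply/andP; split; first exact/hE.
  apply: (emb_leO_dense HF) => v; rewrite -(g'K v) => /hE uv.
  apply: (emb_leK_dense HF) => k; rewrite -(f'K k) => /fg ku.
  by apply/fg; exact: le_trans ku uv.
exists h; split=> //; first exact: inj_surj_bijective.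
- move=> a; split=> Ka.
    have := hK (f' (exist _ _ Ka)); rewrite f'K /= => /h_inj <-.
    exact: svalP.
  by rewrite (hK (exist _ _ Ka)); exact: svalP.
- move=> a; split=> Oa.
    have := hO (g' (exist _ _ Oa)); rewrite g'K /= => /h_inj <-.
    exact: svalP.
  by rewrite (hO (exist _ _ Oa)); exact: svalP.
Qed.

(** * The upset lattice of a ko-space *)

Section UpsetLatticeTheory.
Variables (d : Order.disp_t) (X : porderType d).
Implicit Types (A B : upset_lattice X) (S : set (upset_lattice X)).

Definition to_upset (A : set X) (uA : upset A) : upset_lattice X :=
  SigSub (mem_set (uA : upsets A)).

Lemma upset_latticeP A : upset (val A).
Proof. exact: (set_valP A). Qed.

Lemma upset_leE A B : (A <= B)%O = (val A `<=` val B) :> Prop.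
Proof. by rewrite -subsetEset -Order.le_val. Qed.

Lemma bigcup_upset S : upset (\bigcup_(B in [set val B | B in S]) B).
Proof.
move=> x y xy [_ [B SB <-] Bx].
by exists (val B); [exists B | exact: upset_latticeP xy Bx].
Qed.

Lemma bigcap_upset S : upset (\bigcap_(B in [set val B | B in S]) B).
Proof.
move=> x y xy Sx _ [B SB <-].
by apply: upset_latticeP xy _; apply: Sx; exists B.
Qed.

(** A union of upsets is an upset, so suprema are those of the powerset; [upset_infimums] is the
    analogue for intersections. *)
Lemma upset_supremums S A : supremums S A <->
  val A = \bigcup_(B in [set val B | B in S]) B.
Proof.
split=> [[ub lub] | AE]; last first.
  split=> [B SB | B SB]; rewrite upset_leE AE => x.
    by exists (val B) => //; exists B.
  by case=> _ [C SC <-]; have := SB C SC; rewrite upset_leE; apply.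
apply/seteqP; split=> [|x [_ [B SB <-]]]; last first.
  by have := ub B SB; rewrite upset_leE; apply.
have /lub : ubound S (to_upset (@bigcup_upset S)).
  by move=> B SB; rewrite upset_leE => x Bx; exists (val B) => //; exists B.
by rewrite upset_leE.
Qed.

Lemma upset_infimums S A : infimums S A <->
  val A = \bigcap_(B in [set val B | B in S]) B.
Proof.
split=> [[lb glb] | AE]; last first.
  split=> [B SB | B SB]; rewrite upset_leE AE => x.
    by apply; exists B.
  by move=> Bx _ [C SC <-]; have := SB C SC; rewrite upset_leE; apply.
apply/seteqP; split=> [x Ax _ [B SB <-] | ].
  by have := lb B SB; rewrite upset_leE; apply.
have /glb : lbound S (to_upset (@bigcap_upset S)).
  by move=> B SB; rewrite upset_leE => x; apply; exists B.
by rewrite upset_leE.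
Qed.

Lemma upset_complete_lattice : complete_lattice (upset_lattice X).
Proof.
move=> S; split.
  by exists (to_upset (@bigcup_upset S)); apply/upset_supremums.
by exists (to_upset (@bigcap_upset S)); apply/upset_infimums.
Qed.

Lemma upset_lattice_distributive :
  left_distributive (@Order.meet _ (upset_lattice X)) (@Order.join _ _).
Proof. by move=> A B C; apply: val_inj; exact: setIUl. Qed.

End UpsetLatticeTheory.

(** Density is the point: an upset is the union of the principal upsets of its points and the
    intersection of the complements of principal downsets of the points outside it. The rest
    transcribes the ko-space axioms. *)
Lemma ko_embedded_distr_bidcpo X :
  is_ko_space X -> is_distr_embedded_bidcpo (ko_embedded X).
Proof.
move=> HX; split; last exact: upset_lattice_distributive.
have subK (F : set (ko_embedded X)) : F `<=` emb_K (e := ko_embedded X) ->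
    [set val B | B in F] `<=` ko_K (k := X).
  by move=> FK _ [B /FK KB <-].
have subO (I : set (ko_embedded X)) : I `<=` emb_O (e := ko_embedded X) ->
    [set val B | B in I] `<=` ko_O (k := X).
  by move=> IO _ [B /IO OB <-].
have dirV (I : set (ko_embedded X)) :
    directed (fun A B : ko_embedded X => (A <= B)%O) I ->
    directed subset [set val B | B in I].
  by apply: directed_image => A B; rewrite upset_leE.
have codirV (F : set (ko_embedded X)) :
    codirected (fun A B : ko_embedded X => (A <= B)%O) F ->
    codirected subset [set val B | B in F].
  by apply: codirected_image => A B; rewrite upset_leE.
split.
- exact: upset_complete_lattice.
- move=> A; exists [set B : ko_embedded X | ko_K (val B) /\ (B <= A)%O].
    by move=> B [].
  split=> [B [_ BA] // | B AB]; rewrite upset_leE => x Ax.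
  have ux := ko_K_upset HX (ko_up_K HX x).
  have := AB (to_upset ux).
  rewrite !upset_leE; apply; last exact: lexx.
  split; first exact: ko_up_K.
  by rewrite upset_leE => y /= xy; exact: upset_latticeP xy Ax.
- move=> A; exists [set B : ko_embedded X | ko_O (val B) /\ (A <= B)%O].
    by move=> B [].
  split=> [B [_ AB] // | B BA]; rewrite upset_leE => x Bx.
  apply: contrapT => nAx.
  have ux : upset (~` [set y : X | (y <= x)%O]).
    exact: (ko_O_upset HX (ko_down_O HX x)).
  have := BA (to_upset ux).
  rewrite !upset_leE => H; apply: (H _ x Bx); last exact: lexx.
  split; first exact: ko_down_O.
  by rewrite upset_leE => y Ay /= yx; apply: nAx; exact: upset_latticeP yx Ay.
- move=> F A FK /codirV Fdir /upset_infimums; rewrite /emb_K /= => ->.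
  exact: ko_K_bigcap (subK _ FK) Fdir.
- move=> I A IO /dirV Idir /upset_supremums; rewrite /emb_O /= => ->.
  exact: ko_O_bigcup (subO _ IO) Idir.
- move=> K I A KK IO /dirV Idir /upset_supremums AE; rewrite upset_leE AE.
  move/(ko_K_compact HX KK (subO _ IO) Idir).
  by case=> _ [B IB <-] KB; exists B => //; rewrite upset_leE.
- move=> U F A OU FK /codirV Fdir /upset_infimums AE; rewrite upset_leE AE.
  move/(ko_O_cocompact HX OU (subK _ FK) Fdir).
  by case=> _ [B FB <-] BU; exists B => //; rewrite upset_leE.
Qed.

Lemma ko_embedded_polarity X : is_ko_space X ->
  pol_iso (emb_polarity (ko_embedded X)) (ko_polarity X).
Proof.
move=> HX.
have [f fbij fE] : exists2 f :
    pol_K (emb_polarity (ko_embedded X)) -> pol_K (ko_polarity X),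
    bijective f & forall A, sval (f A) = val (sval A).
  apply: (@sig_bijection _ _ (emb_K (e := ko_embedded X)) (ko_K (k := X))
    (fun A => val A)) => // [A B _ _ /val_inj // | A KA].
  by exists (to_upset (ko_K_upset HX KA)).
have [g gbij gE] : exists2 g :
    pol_O (emb_polarity (ko_embedded X)) -> pol_O (ko_polarity X),
    bijective g & forall A, sval (g A) = val (sval A).
  apply: (@sig_bijection _ _ (emb_O (e := ko_embedded X)) (ko_O (k := X))
    (fun A => val A)) => // [A B _ _ /val_inj // | A OA].
  by exists (to_upset (ko_O_upset HX OA)).
exists f, g; split=> // A U.
by rewrite /= fE gE upset_leE.
Qed.

(** * The ko-space of points of a distributive bi-dcpo *)

(** Zorn's lemma for the reverse of [R] on the elements of [Q] below [x]: a nonempty chain is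
    codirected. With [R] reversed, it gives maximal elements above [x]. *)
Lemma exists_minimal_below T (R : T -> T -> Prop) (Q : T -> Prop) (x : T) :
  (forall y, R y y) -> (forall y z t, R y z -> R z t -> R y t) ->
  (forall y z, R y z -> R z y -> y = z) ->
  (forall F, codirected R F -> F `<=` Q ->
    exists2 m, Q m & forall y, F y -> R m y) ->
  Q x ->
  exists p, [/\ R p x, Q p & forall y, R y p -> Q y -> y = p].
Proof.
move=> Rrefl Rtrans Ranti Qlb Qx.
pose below := {y | Q y /\ R y x}.
pose ge (y z : below) := `[< R (sval z) (sval y) >].
have ge_refl y : ge y y by apply/asboolP.
have ge_trans y z t : ge y z -> ge z t -> ge y t.
  by move=> /asboolP zy /asboolP tz; apply/asboolP; exact: Rtrans tz zy.
have ge_anti y z : ge y z -> ge z y -> y = z.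
  by move=> /asboolP zy /asboolP yz; apply: sval_inj; exact: Ranti.
have [C totC | [p [Qp px]] pmin] := Zorn ge_refl ge_trans ge_anti; last first.
  exists p; split=> // y yp Qy.
  have /pmin/(congr1 sval) // : ge (exist _ p (conj Qp px))
    (exist _ y (conj Qy (Rtrans _ _ _ yp px))) by apply/asboolP.
(* The empty chain is not codirected and is bounded by [x] itself. *)
have [[c Cc] | C0] := pselect (C !=set0); last first.
  exists (exist _ x (conj Qx (Rrefl x))) => s Cs.
  by case: C0; exists s.
have [||m Qm mC] := Qlb [set sval y | y in C].
- split; first by exists (sval c), c.
  move=> _ _ [y Cy <-] [z Cz <-].
  have [/asboolP zy | /asboolP yz] := totC y z Cy Cz.
    by exists (sval z); split=> //; exists z.
  by exists (sval y); split=> //; exists y.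
- by move=> _ [y _ <-]; have [] := svalP y.
have mx : R m x.
  by apply: Rtrans (mC _ _) (svalP c).2; exists c.
exists (exist _ m (conj Qm mx)) => s Cs; apply/asboolP => /=.
by apply: mC; exists s.
Qed.

Section Points.
Variables (P : polarity) (HP : is_distr_bidcpo P).

Definition is_point (x : pol_K P * pol_O P) : Prop :=
  [/\ ~ x.1 ◁ x.2,
      forall l, pol_leK l x.1 -> ~ l ◁ x.2 -> l = x.1 &
      forall v, pol_leO x.2 v -> ~ x.1 ◁ v -> v = x.2].

Let antiK (k l : pol_K P) : pol_leK k l -> pol_leK l k -> k = l.
Proof. by have /pol_purifiedP[+ _] := bidcpo_purified HP.1; exact. Qed.

Let antiO (u v : pol_O P) : pol_leO u v -> pol_leO v u -> u = v.
Proof. by have /pol_purifiedP[_ +] := bidcpo_purified HP.1; exact. Qed.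

(* The only use of distributivity: at a point, minimality and maximality
   discharge its hypotheses (iii) and (i). *)
Lemma point_leK x k : is_point x -> pol_leK x.1 k <-> ~ k ◁ x.2.
Proof.
case: x => p q [/= npq pmin qmax]; split=> [pk /pk // | nkq w kw].
apply: contrapT => npw; apply: npq; apply: (HP.2 p k q w) => //.
  move=> w' qw' kw'; apply: contrapT => npw'.
  by move: kw'; rewrite (qmax w' qw' npw').
move=> m mw mp; apply: contrapT => nmq.
by move: mw; rewrite (pmin m mp nmq).
Qed.

(** Dual of [point_leK], and a consequence of it: if [k] is related to [u] but not to [x.2], then
    [x.1] is below [k] and so is related to [u]. *)
Lemma point_relE x u : is_point x -> x.1 ◁ u <-> ~ pol_leO u x.2.
Proof.
move=> px; split=> [pu /(_ _ pu) pq | nuq]; first by case: px.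
apply: contrapT => npu; apply: nuq => k ku; apply: contrapT.
by move=> /(point_leK _ px)/(_ u ku).
Qed.

(** Zorn's lemma is used twice: first to shrink [k] to a minimal [p] unrelated to [u], then to
    enlarge [u] to a maximal [q] unrelated to [p]. Cocompactness and compactness supply the bounds
    of chains. *)
Lemma exists_point k u : ~ k ◁ u ->
  exists x, [/\ is_point x, pol_leK x.1 k & pol_leO u x.2].
Proof.
move=> nku.
have [F Fdir Fu | p [pk npu pmin]] := exists_minimal_below (R := @pol_leK P)
    (Q := fun l => ~ l ◁ u) (@pol_leK_refl P) (@pol_leK_trans P) antiK _ nku.
  have [m mF] := bidcpo_meets HP.1 Fdir; exists m; last exact: mF.1.
  by move=> /(bidcpo_cocompact HP.1 Fdir mF)[l /Fu].
have geO_trans (v w t : pol_O P) :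
    pol_leO w v -> pol_leO t w -> pol_leO t v.
  by move=> wv tw; exact: pol_leO_trans tw wv.
have [I Idir Ip | q [uq npq qmax]] := exists_minimal_below
    (R := fun v w => pol_leO w v) (Q := fun v => ~ p ◁ v) (@pol_leO_refl P)
    geO_trans (fun v w vw wv => antiO wv vw) _ npu.
  have [m mI] := bidcpo_joins HP.1 (I := I) Idir; exists m; last exact: mI.1.
  by move=> /(bidcpo_compact HP.1 (I := I) Idir mI)[v /Ip].
(* Minimality of [p] survives the passage from [u] to [q]: what is unrelated to [q] is unrelated to
   the smaller [u]. *)
exists (p, q); split=> //; split=> //= l lp nlq.
by apply: pmin => // lu; apply: nlq; exact: uq.
Qed.

(* The proof argument is what lets the order, antisymmetric only in the
   distributive case, be declared as an instance on this type. *)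
Definition points of is_distr_bidcpo P : Type := {x | is_point x}.

HB.instance Definition _ := gen_eqMixin (points HP).
HB.instance Definition _ := gen_choiceMixin (points HP).

(** The order is reversed because principal upsets shrink as their points grow. *)
Definition point_le (x y : points HP) : bool :=
  `[< pol_leK (sval y).1 (sval x).1 >].

Lemma point_le_refl : reflexive point_le.
Proof. by move=> x; apply/asboolP; exact: pol_leK_refl. Qed.

(** The first component of a point determines the second: by [point_relE], the elements below [x.2]
    are those to which [x.1] is unrelated. *)
Lemma point_le_anti : antisymmetric point_le.
Proof.
move=> x y /andP[/asboolP yx /asboolP xy]; apply: sval_inj.
have K : (sval x).1 = (sval y).1 by exact: antiK.
have O : (sval x).2 = (sval y).2.
  have [[nx _ _] [ny _ _]] := (svalP x, svalP y).
  apply: antiO; apply: contrapT.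
    by move/(point_relE _ (svalP y)); rewrite -K.
  by move/(point_relE _ (svalP x)); rewrite K.
by rewrite [sval x]surjective_pairing K O -surjective_pairing.
Qed.

Lemma point_le_trans : transitive point_le.
Proof.
move=> y x z /asboolP yx /asboolP zy; apply/asboolP.
exact: pol_leK_trans zy yx.
Qed.

HB.instance Definition _ := Order.Le_isPOrder.Build (Order.Disp tt tt)
  (points HP) point_le_refl point_le_anti point_le_trans.

Lemma points_leE (x y : points HP) :
  (x <= y)%O = pol_leK (sval y).1 (sval x).1 :> Prop.
Proof. by apply/propext; split=> [/asboolP | /asboolP]. Qed.

(** With [x.1] in the role of the upset of [x], this and [point_inside] are the membership criteria
    that hold in the polarity of a ko-space. *)
Definition point_above (k : pol_K P) : set (points HP) :=
  [set x | pol_leK (sval x).1 k].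

Definition point_inside (u : pol_O P) : set (points HP) :=
  [set x | (sval x).1 ◁ u].

Definition points_ko : ko_data :=
  @KoData _ (points HP) (range point_above) (range point_inside).

(** There are enough points: if [k] is unrelated to [u], the point from [exists_point] lies in the
    first set and not in the second. Both specialization orders thereby become inclusion. *)
Lemma point_above_inside k u : point_above k `<=` point_inside u <-> k ◁ u.
Proof.
split=> [ku | ku x xk]; last exact: xk.
apply: contrapT => /exists_point[x [px xk ux]].
have := ku (exist _ x px) xk; rewrite /point_inside /=.
by move/(point_relE _ px).
Qed.

Lemma point_above_sub k l : point_above k `<=` point_above l <-> pol_leK k l.
Proof.
split=> [kl u /= /point_above_inside lu | kl x xk].
  exact/point_above_inside/(subset_trans kl).
exact: pol_leK_trans xk kl.
Qed.

Lemma point_inside_sub u v : point_inside u `<=` point_inside v <-> pol_leO u v.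
Proof.
split=> [uv k /= /point_above_inside ku | uv x]; last exact: uv.
exact/point_above_inside/(subset_trans ku).
Qed.

(** * The ko-space axioms for the points *)

Lemma points_codirected (F : set (set (points HP))) :
  F `<=` range point_above -> codirected subset F ->
  exists2 G, codirected (@pol_leK P) G & F = [set point_above k | k in G].
Proof.
move=> FK [[A FA] Fdir]; exists [set k | F (point_above k)]; last first.
  by apply/seteqP; split=> [B FB | _ [k Fk <-] //]; have [k _ kB] := FK B FB;
    exists k; rewrite //= kB.
split; first by have [k _ kA] := FK A FA; exists k; rewrite /= kA.
move=> k l Fk Fl; have [B [FB Bk Bl]] := Fdir _ _ Fk Fl.
have [m _ mB] := FK B FB; exists m; rewrite /= mB.
by split=> //; apply/point_above_sub; rewrite mB.
Qed.

Lemma points_directed (I : set (set (points HP))) :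
  I `<=` range point_inside -> directed subset I ->
  exists2 J, directed (@pol_leO P) J & I = [set point_inside u | u in J].
Proof.
move=> IO [[A IA] Idir]; exists [set u | I (point_inside u)]; last first.
  by apply/seteqP; split=> [B IB | _ [u Iu <-] //]; have [u _ uB] := IO B IB;
    exists u; rewrite //= uB.
split; first by have [u _ uA] := IO A IA; exists u; rewrite /= uA.
move=> u v Iu Iv; have [B [IB uB vB]] := Idir _ _ Iu Iv.
have [w _ wB] := IO B IB; exists w; rewrite /= wB.
by split=> //; apply/point_inside_sub; rewrite wB.
Qed.

Lemma point_above_meet G k : is_meet (@pol_leK P) G k ->
  \bigcap_(A in [set point_above l | l in G]) A = point_above k.
Proof.
case=> lb glb; apply/seteqP; split=> [x Gx | x xk _ [l Gl <-]].
  by apply: glb => l Gl; apply: (Gx (point_above l)); exists l.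
exact: pol_leK_trans xk (lb l Gl).
Qed.

(** Unlike [point_above_meet], which is the universal property of the meet, this needs compactness,
    applied to the first component of a point. *)
Lemma point_inside_join J u : directed (@pol_leO P) J ->
  is_join (@pol_leO P) J u ->
  \bigcup_(A in [set point_inside v | v in J]) A = point_inside u.
Proof.
move=> Jdir Ju; apply/seteqP; split=> [x [_ [v Jv <-] xv] | x xu].
  exact: (Ju.1 v Jv).
have [v Jv xv] := bidcpo_compact HP.1 Jdir Ju xu.
by exists (point_inside v) => //; exists v.
Qed.

Lemma points_ko_space : is_ko_space points_ko.
Proof.
split.
- move=> _ [k _ <-] x y; rewrite points_leE => yx xk.
  exact: pol_leK_trans yx xk.
- by move=> _ [u _ <-] x y; rewrite points_leE; exact.
- move=> F FK /(points_codirected FK)[G Gdir ->].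
  have [k Gk] := bidcpo_meets HP.1 Gdir.
  by rewrite (point_above_meet Gk); exists k.
- move=> I IO /(points_directed IO)[J Jdir ->].
  have [u Ju] := bidcpo_joins HP.1 Jdir.
  by rewrite (point_inside_join Jdir Ju); exists u.
- move=> _ I [k _ <-] IO /(points_directed IO)[J Jdir ->].
  have [u Ju] := bidcpo_joins HP.1 Jdir.
  rewrite (point_inside_join Jdir Ju) => /point_above_inside.
  move=> /(bidcpo_compact HP.1 Jdir Ju)[v Jv kv].
  by exists (point_inside v); [exists v | exact/point_above_inside].
- move=> _ F [u _ <-] FK /(points_codirected FK)[G Gdir ->].
  have [k Gk] := bidcpo_meets HP.1 Gdir.
  rewrite (point_above_meet Gk) => /point_above_inside.
  move=> /(bidcpo_cocompact HP.1 Gdir Gk)[l Gl lu].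
  by exists (point_above l); [exists l | exact/point_above_inside].
- move=> x; exists (sval x).1 => //.
  by apply/seteqP; split=> y yx; exact/asboolP.
(* By [point_leK], [y] is below [x] exactly when the first component of [y] is unrelated to the
   second component of [x]. *)
- move=> x; exists (sval x).2 => //.
  suff : point_inside (sval x).2 = ~` [set y : points HP | (y <= x)%O] by [].
  apply/seteqP; split=> y; rewrite /point_inside /=.
    by move=> yx /asboolP/(point_leK _ (svalP x)).
  move=> nyx; apply: contrapT => /(point_leK _ (svalP x)) yx.
  by apply: nyx; exact/asboolP.
Qed.

(** Both families are ranges, which gives surjectivity; injectivity is purification. *)
Lemma points_ko_polarity : pol_iso (ko_polarity points_ko) P.
Proof.
apply: pol_iso_sym.
exists (fun k => exist _ (point_above k) (imageT point_above k)).
exists (fun u => exist _ (point_inside u) (imageT point_inside u)).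
split; last exact: point_above_inside.
  apply: inj_surj_bijective => [k l [kl] | [A /[dup][[k _ kA] KA]]].
    by apply: antiK; apply/point_above_sub; rewrite kl.
  by exists k; exact: eq_exist.
apply: inj_surj_bijective => [u v [uv] | [U /[dup][[u _ uU] OU]]].
  by apply: antiO; apply/point_inside_sub; rewrite uv.
by exists u; exact: eq_exist.
Qed.

End Points.

(** * The three correspondences *)

Theorem theorem4p18 :
  [/\ iso_class_bijection is_ko_space ko_iso
        is_distr_bidcpo pol_iso ko_polarity,
      iso_class_bijection is_ko_space ko_iso
        is_distr_embedded_bidcpo emb_iso ko_embedded,
      iso_class_bijection is_distr_embedded_bidcpo emb_iso
        is_distr_bidcpo pol_iso emb_polarity &
      forall X : ko_data, is_ko_space X ->
        pol_iso (emb_polarity (ko_embedded X)) (ko_polarity X)].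
Proof.
have ko_surj P : is_distr_bidcpo P ->
    exists2 X, is_ko_space X & pol_iso (ko_polarity X) P.
  move=> HP; exists (points_ko HP); first exact: points_ko_space.
  exact: points_ko_polarity.
have emb_surj P : is_distr_bidcpo P ->
    exists2 E, is_distr_embedded_bidcpo E & pol_iso (emb_polarity E) P.
  move=> /ko_surj[X HX XP]; exists (ko_embedded X).
    exact: ko_embedded_distr_bidcpo.
  exact: pol_iso_trans (ko_embedded_polarity HX) XP.
split.
- apply: iso_class_bijectionP.
  + exact: ko_iso_refl.
  + exact: ko_iso_trans.
  + exact: pol_iso_refl.
  + exact: pol_iso_sym.
  + exact: pol_iso_trans.
  + exact: ko_polarity_distr_bidcpo.
  + move=> X Y HX HY; split; last exact: ko_polarity_iso.
    exact: ko_polarity_reflects_iso.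
  + exact: ko_surj.
- apply: iso_class_bijectionP.
  + exact: ko_iso_refl.
  + exact: ko_iso_trans.
  + exact: emb_iso_refl.
  + exact: emb_iso_sym.
  + exact: emb_iso_trans.
  + exact: ko_embedded_distr_bidcpo.
  (* Both directions pass through polarities, where the upset lattice and the space agree. *)
  + move=> X Y HX HY.
    have [[EX _] [EY _]] :=
      (ko_embedded_distr_bidcpo HX, ko_embedded_distr_bidcpo HY).
    split=> XY.
      apply: ko_polarity_reflects_iso => //.
      apply: pol_iso_trans (pol_iso_sym (ko_embedded_polarity HX)) _.
      apply: pol_iso_trans (ko_embedded_polarity HY).
      exact: emb_polarity_iso.
    apply: emb_polarity_reflects_iso => //.
    apply: pol_iso_trans (ko_embedded_polarity HX) _.
    apply: pol_iso_trans (pol_iso_sym (ko_embedded_polarity HY)).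
    exact: ko_polarity_iso.
  (* Realize the polarity of [E] by a ko-space; its upset lattice has the same polarity as [E] up to
     isomorphism, hence is isomorphic to [E]. *)
  + move=> E HE; have [X HX XE] := ko_surj _ (emb_polarity_distr_bidcpo HE).
    exists X => //; apply: emb_polarity_reflects_iso.
    * by have [] := ko_embedded_distr_bidcpo HX.
    * by have [] := HE.
    * exact: pol_iso_trans (ko_embedded_polarity HX) XE.
- apply: iso_class_bijectionP.
  + exact: emb_iso_refl.
  + exact: emb_iso_trans.
  + exact: pol_iso_refl.
  + exact: pol_iso_sym.
  + exact: pol_iso_trans.
  + exact: emb_polarity_distr_bidcpo.
  + move=> E F [HE _] [HF _]; split; last exact: emb_polarity_iso.
    exact: emb_polarity_reflects_iso.
  + exact: emb_surj.
- exact: ko_embedded_polarity.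
Qed.
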